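(* Let $d\ge 1$, $\eta>0$, $\sigma>1$, $\alpha\ge 1$, and $0<\epsilon<\eta$. Consider the distribution $\mathcal{D}$ on $\mathbb{R}^d\times\{-1,+1\}$: $y$ uniform on $\{-1,+1\}$, $\bm{\mu}=(\eta,\dots,\eta)$, $\bm{x}\mid y=+1\sim\mathcal{N}(\bm{\mu},\sigma^2 I)$, $\bm{x}\mid y=-1\sim\mathcal{N}(-\alpha\bm{\mu},I)$. Consider linear classifiers $f(\bm{x})=\operatorname{sign}(\bm{w}^\top\bm{x}+b)$ with $\|\bm{w}\|_2=1$, $b\in\mathbb{R}$; let $\mathcal{R}_{nat}(f\mid y)=\Pr(f(\bm{x})\neq y\mid y)$ and $\mathcal{R}_{rob}(f\mid y)=\Pr(\exists\bm{\delta},\|\bm{\delta}\|_\infty\le\epsilon: f(\bm{x}+\bm{\delta})\neq y\mid y)$, and let $f_{nat}$, $f_{rob}$ be minimizers over $(\bm{w},b)$ of the total standard error $\Pr(f(\bm{x})\ne y)$ and the total robust error, respectively. For a classifier $f$ and an error notion $\mathcal{R}$ define the disparity $D(\mathcal{R}(f))=\mathcal{R}(f\mid +1)-\mathcal{R}(f\mid -1)$. Let $A=\frac{2\sqrt{d}\sigma}{\sigma^2-1}$ and $h(\sigma)=\frac{2\sigma^2\log\sigma}{\sigma^2-1}$. Then, both for $(\mathcal{R},f)=(\mathcal{R}_{nat},f_{nat})$ with $g(\alpha)=\frac{1+\alpha}{2}\eta$ and for $(\mathcal{R},f)=(\mathcal{R}_{rob},f_{rob})$ with $g(\alpha)=\frac{1+\alpha}{2}\eta-\epsilon$,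 $$D(\mathcal{R}(f))=\Pr\Big(\tfrac{A}{\sigma}g(\alpha)-\sqrt{A^2g^2(\alpha)+h(\sigma)}<\mathcal{N}(0,1)<-Ag(\alpha)+\sqrt{\big(\tfrac{A}{\sigma}\big)^2g^2(\alpha)+\tfrac{h(\sigma)}{\sigma^2}}\Big),$$ and this disparity decreases monotonically as $\alpha$ increases.
   Context: $\Pr(a<\mathcal{N}(0,1)<b)$ denotes the probability that a standard normal variable lies in $(a,b)$. $I$ is the $d\times d$ identity matrix. *)

(* Defs.v *)
From HB Require Import structures.
From mathcomp Require Import all_boot all_order all_algebra.
From mathcomp Require Import all_classical all_reals all_analysis.
Set Implicit Arguments. Unset Strict Implicit. Unset Printing Implicit Defensive.
Import Order.TTheory GRing.Theory Num.Theory.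
Import numFieldNormedType.Exports.
Local Open Scope classical_set_scope.
Local Open Scope ring_scope.

Section defs.
Context {R : realType} {dT : measure_display} {T : measurableType dT}.

(* Mutual independence of the finite family (Z i)_{i < n} of real random
   variables: product rule for every family of Borel sets (taking B i = setT
   recovers every subfamily). *)
Definition mutually_independent (n : nat) (P : probability T R)
    (Z : 'I_n -> {RV P >-> R}) : Prop :=
  forall B : 'I_n -> set R, (forall i, measurable (B i)) ->
    P (\bigcap_(i in [set: 'I_n]) (Z i @^-1` B i)) =
    (\prod_(i < n) P (Z i @^-1` B i))%E.

Definition std_normal_rv (P : probability T R) (X : {RV P >-> R}) : Prop :=
  distribution P X = normal_prob 0 1.

(* The linear classifier f(x) = sign(w^T x + b), with the tie convention
   sign(0) = +1 (a null event for Gaussian data). Labels are the reals 1, -1. *)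
Definition lin_clf (n : nat) (w : 'I_n -> R) (b : R) (x : 'I_n -> R) : R :=
  if 0 <= \sum_(i < n) w i * x i + b then 1 else -1.

Definition unit_l2 (n : nat) (w : 'I_n -> R) : Prop :=
  \sum_(i < n) w i ^+ 2 = 1.

(* Class-conditional sample: x = m*(1,...,1) + s*Z, i.e. x ~ N(m 1, s^2 I)
   when the Z i are iid N(0,1). *)
Definition gauss_pt (n : nat) (P : probability T R) (Z : 'I_n -> {RV P >-> R})
    (m s : R) (t : T) : 'I_n -> R := fun i => m + s * Z i t.

Definition nat_err (n : nat) (P : probability T R) (Z : 'I_n -> {RV P >-> R})
    (m s y : R) (w : 'I_n -> R) (b : R) : R :=
  fine (P [set t | lin_clf w b (gauss_pt Z m s t) != y]).

Definition rob_err (n : nat) (P : probability T R) (Z : 'I_n -> {RV P >-> R})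
    (eps m s y : R) (w : 'I_n -> R) (b : R) : R :=
  fine (P [set t | exists delta : 'I_n -> R,
      (forall i, `|delta i| <= eps) /\
      lin_clf w b (fun i => gauss_pt Z m s t i + delta i) != y]).

(* Model D: y uniform on {-1,+1}, x | y=+1 ~ N(eta 1, sigma^2 I),
   x | y=-1 ~ N(-alpha eta 1, I). Conditional errors for y = +1 / y = -1. *)
Definition Rnat_pos n P Z (eta sigma : R) w b := @nat_err n P Z eta sigma 1 w b.
Definition Rnat_neg n P Z (eta alpha : R) w b :=
  @nat_err n P Z (- (alpha * eta)) 1 (-1) w b.
Definition Rrob_pos n P Z (eps eta sigma : R) w b :=
  @rob_err n P Z eps eta sigma 1 w b.
Definition Rrob_neg n P Z (eps eta alpha : R) w b :=
  @rob_err n P Z eps (- (alpha * eta)) 1 (-1) w b.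

(* total errors (y uniform) *)
Definition tot_nat n P Z eta sigma alpha w b :=
  (@Rnat_pos n P Z eta sigma w b + @Rnat_neg n P Z eta alpha w b) / 2.
Definition tot_rob n P Z eps eta sigma alpha w b :=
  (@Rrob_pos n P Z eps eta sigma w b + @Rrob_neg n P Z eps eta alpha w b) / 2.

Definition is_f_nat n P Z eta sigma alpha (w : 'I_n -> R) (b : R) : Prop :=
  unit_l2 w /\ forall w' b', unit_l2 w' ->
    @tot_nat n P Z eta sigma alpha w b <= @tot_nat n P Z eta sigma alpha w' b'.
Definition is_f_rob n P Z eps eta sigma alpha (w : 'I_n -> R) (b : R) : Prop :=
  unit_l2 w /\ forall w' b', unit_l2 w' ->
    @tot_rob n P Z eps eta sigma alpha w b <=
    @tot_rob n P Z eps eta sigma alpha w' b'.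

Definition disp_nat n P Z eta sigma alpha w b :=
  @Rnat_pos n P Z eta sigma w b - @Rnat_neg n P Z eta alpha w b.
Definition disp_rob n P Z eps eta sigma alpha w b :=
  @Rrob_pos n P Z eps eta sigma w b - @Rrob_neg n P Z eps eta alpha w b.

End defs.

Definition std_normal_interval {R : realType} (a c : R) : R :=
  fine (normal_prob 0 1 `]a, c[).

Definition A_const {R : realType} (n : nat) (sigma : R) : R :=
  2 * Num.sqrt (n%:R) * sigma / (sigma ^+ 2 - 1).
Definition h_fun {R : realType} (sigma : R) : R :=
  2 * sigma ^+ 2 * ln sigma / (sigma ^+ 2 - 1).

Definition disparity_formula {R : realType} (n : nat) (sigma g : R) : R :=
  let A := A_const n sigma in let h := h_fun sigma in
  std_normal_interval (A / sigma * g - Num.sqrt (A ^+ 2 * g ^+ 2 + h))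
                      (- (A * g) + Num.sqrt ((A / sigma) ^+ 2 * g ^+ 2 + h / sigma ^+ 2)).

Definition g_nat {R : realType} (eta alpha : R) : R := (1 + alpha) / 2 * eta.
Definition g_rob {R : realType} (eps eta alpha : R) : R :=
  (1 + alpha) / 2 * eta - eps.

(* Main.v *)
Require Import Defs.
From HB Require Import structures.
From mathcomp Require Import all_boot all_order all_algebra.
From mathcomp Require Import all_classical all_reals all_analysis.
From mathcomp Require Import measurable_realfun ring lra.
Import Order.TTheory GRing.Theory Num.Theory.
Import numFieldNormedType.Exports.
Local Open Scope classical_set_scope.
Local Open Scope ring_scope.

(** For a unit vector [w] the combination [\sum_i w i * Z i] is again standard
    normal, so the conditional errors are values of the normal distribution
    function [Phi] depending on [w] only through [\sum_i w i] and
    [\sum_i `|w i|] (the worst perturbation is [eps * sg (w i)]).  Since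
    [eps < eta <= alpha * eta] and both sums are at most [sqrt d], a minimizer
    has both sums equal to [sqrt d].  What remains is to minimize, up to a
    factor, [Phi ((u - M) / sigma) + Phi (- u)] with [M = 2 * sqrt d * g]; its
    critical points solve [u^2 = ((u - M) / sigma)^2 + 2 * ln sigma], and the
    larger root is the only minimum.  At this point the two densities balance,
    which makes the derivative of the disparity in [g] a positive multiple of
    [2 * a / sqrt (a^2 + h) - sigma - 1 / sigma < 0], where [a = A * g].  The
    standard error is the robust error with [eps = 0]. *)

(** * The standard normal distribution function *)

Section normal_cdf.
Context {R : realType}.
Implicit Types (m s x y : R).
Local Notation mu := (@lebesgue_measure R).
Local Notation phi := (normal_pdf (0 : R) 1).

Lemma normal_pdf_gt0 m s x : s != 0 -> 0 < normal_pdf m s x.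
Proof.
by move=> s0; rewrite normal_pdfE// mulr_gt0 ?normal_peak_gt0 ?expR_gt0.
Qed.

(** Differences of rays give the half-open bounded intervals, and a measure that agrees on these
    with the Lebesgue-Stieltjes measure of a distribution function equals it. *)
Lemma eq_probability_itvNyc (P Q : probability (measurableTypeR R) R) :
  (forall t : R, P `]-oo, t]%classic = Q `]-oo, t]%classic) ->
  forall A, measurable A -> P A = Q A.
Proof.
move=> PQ A mA.
have itvE (a b : R) :
    `]a, b]%classic = `]-oo, b]%classic `\` `]-oo, a]%classic.
  by rewrite -[RHS]setCK setCD setCitvl setUC -[LHS]setCK setCitv.
have PQab (a b : R) : P `]a, b]%classic = Q `]a, b]%classic.
  have [ab|ba] := leP a b; last first.
    by rewrite set_itv_ge ?measure0// bnd_simp -leNgt ltW.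
  have fin (M : probability (measurableTypeR R) R) :
      M `]a, b]%classic = (M `]-oo, b]%classic - M `]-oo, a]%classic)%E.
    rewrite itvE measureD ?setIidr//; first exact: subset_itvl.
    by rewrite -ge0_fin_numE// fin_num_measure.
  by rewrite !fin !PQ.
rewrite -[RHS](lebesgue_stieltjes_cdf_id Q mA).
apply/esym/lebesgue_stieltjes_measure_unique => // _ [[a b]] _ <-.
by rewrite lebesgue_stieltjes_cdf_id//; exact/esym/PQab.
Qed.

Definition Phi x : R := fine (normal_prob 0 1 `]-oo, x]).

(** Substitute [- x] for [x]; the density is even. *)
Lemma normal_probN_ge c : normal_prob (0 : R) 1 `[c, +oo[ = normal_prob 0 1 `]-oo, - c].
Proof.
rewrite /normal_prob.
have := @ge0_integration_by_substitutionNy R (normal_pdf 0 1) c.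
move=> ->; last 2 first.
- apply: continuous_subspaceT.
  exact/continuous_normal_pdf/oner_neq0.
- by move=> x _; exact: normal_pdf_ge0.
by apply: eq_integral => x _; rewrite /= !normal_pdfE ?oner_neq0//
  /normal_fun !subr0 sqrrN.
Qed.

Lemma is_derive_Phi x : is_derive x 1 Phi (phi x).
Proof.
(* The right end [x + 1] is only some point beyond [x], so that [x] is interior to the domain. *)
have := @continuous_FTC1 R (normal_pdf 0 1) -oo%O x (x + 1).
rewrite ltrDl ltr01 => /(_ isT) => h.
have [||//|d1 d2] := h.
- apply: integrableS (integrable_normal_pdf 0 1) => //.
- by rewrite ltNyr.
- by apply: continuous_normal_pdf; exact: oner_neq0.
apply: DeriveDef; first exact: d1.
by rewrite -derive1E.
Qed.

Lemma PhiE x : normal_prob 0 1 `]-oo, x] = (Phi x)%:E.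
Proof. by rewrite /Phi fineK// fin_num_measure. Qed.

Lemma normal_prob_itvNyo x : normal_prob 0 1 `]-oo, x[ = (Phi x)%:E.
Proof.
rewrite -PhiE /normal_prob integral_itv_bndo_bndc//.
apply: measurable_funTS; apply/measurable_EFinP; exact: measurable_normal_pdf.
Qed.

Lemma normal_prob_itvcy x : normal_prob 0 1 `[x, +oo[ = (Phi (- x))%:E.
Proof. by rewrite normal_probN_ge PhiE. Qed.

Lemma std_normal_intervalE x y : x <= y ->
  std_normal_interval x y = Phi y - Phi x.
Proof.
move=> xy; rewrite /std_normal_interval.
have -> : normal_prob (0 : R) 1 `]x, y[ = normal_prob 0 1 `]x, y].
  rewrite /normal_prob integral_itv_bndo_bndc//.
  by apply: measurable_funTS; apply/measurable_EFinP; exact: measurable_normal_pdf.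
have -> : `]x, y]%classic = `]-oo, y]%classic `\` `]-oo, x]%classic.
  by rewrite -[RHS]setCK setCD setCitvl setUC -[LHS]setCK setCitv.
have := @measureD _ _ _ (normal_prob (0 : R) 1) `]-oo, y]%classic `]-oo, x]%classic.
rewrite setIidr; last exact: subset_itvl.
move=> /= ->//; first by rewrite !PhiE.
by rewrite -ge0_fin_numE ?measure_ge0// fin_num_measure.
Qed.

Lemma Phi_lt : {homo Phi : x y / x < y}.
Proof.
move=> x y xy.
apply: (@gtr0_derive1_lt R Phi x y _ _ true false).
- by move=> z _; have [] := is_derive_Phi z.
- move=> z _; have [_ dz] := is_derive_Phi z.
  by rewrite derive1E dz normal_pdf_gt0// oner_neq0.
- apply: derivable_within_continuous => z _; by have [] := is_derive_Phi z.
- by rewrite in_itv/= lexx ltW.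
- by rewrite in_itv/= lexx ltW.
- by [].
Qed.

End normal_cdf.

(** * Affine images and sums of normal laws *)

Section normal_sum.
Context {R : realType}.
Implicit Types (m s x y : R).
Local Notation mu := (@lebesgue_measure R).

(** The Radon-Nikodym derivative and [normal_pdf] have equal integrals over every measurable set,
    hence agree almost everywhere. *)
Lemma integral_normal_prob m s (f : R -> \bar R) :
  (normal_prob m s).-integrable [set: R] f ->
  (\int[normal_prob m s]_x f x = \int[mu]_x (f x * (normal_pdf m s x)%:E))%E.
Proof.
move=> intf; have mf := measurable_int _ intf.
have mpdf : measurable_fun [set: R] (fun x => (normal_pdf m s x)%:E).
  by apply/measurable_EFinP; exact: measurable_normal_pdf.
rewrite -(Radon_Nikodym_change_of_variables (normal_prob_dominates m s))//=.
apply: ae_eq_integral => //.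
- apply: emeasurable_funM => //; apply: (measurable_int mu).
  by apply: Radon_Nikodym_integrable; exact: normal_prob_dominates.
- exact: emeasurable_funM.
- apply: ae_eqe_mul2l => /=.
  rewrite Radon_NikodymE//=; first exact: normal_prob_dominates.
  move=> dom; case: cid => /= h [h1 h2 h3].
  by apply: integral_ae_eq => //= E _ mE; rewrite -h3.
Qed.

(** Substitute [(z - x) / w]: the Jacobian [w^-1] turns the peak of deviation 1 into the peak of
    deviation [w]. *)
Lemma normal_prob_affine (t x w : R) : 0 < w ->
  normal_prob 0 1 `]-oo, (t - x) / w] = normal_prob x w `]-oo, t].
Proof.
move=> w0; pose F (z : R) := (z - x) / w.
have dF (z : R) : is_derive z 1 F w^-1.
  rewrite /F; apply: is_derive_eq; rewrite !scaler0 add0r subr0.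
  by rewrite /GRing.scale/= mulr1.
have F'E : (F^`())%classic = cst w^-1.
  by apply/funext => z; rewrite derive1E derive_val.
rewrite /normal_prob -/(F t).
have -> := @increasing_ge0_integration_by_substitutionNy R F (normal_pdf 0 1) t.
- apply: eq_integral => z _; congr EFin.
  rewrite F'E /= fctE/= !normal_pdfE ?oner_neq0 ?gt_eqF//= /normal_fun /F subr0.
  have -> : normal_peak 1 = w * normal_peak w :> R.
    rewrite /normal_peak expr1n mul1r -mulrnAr sqrtrM ?sqr_ge0// sqrtr_sqr gtr0_norm//.
    by rewrite invfM mulVKf ?gt_eqF.
  rewrite mulrAC (mulrC w) mulfK ?gt_eqF//; congr (_ * expR _).
  by rewrite expr1n; field; rewrite gt_eqF.
- move=> a b _ _ ab; rewrite /F ltr_pM2r ?invr_gt0//; lra.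
- by rewrite F'E => z _; exact: cvg_cst.
- rewrite F'E; exact: is_cvg_cst.
- rewrite F'E; exact: cvg_cst.
- split.
    by move=> z _; exact: ex_derive.
  have : derivable F t 1 by exact: ex_derive.
  move=> /derivable1_diffP /differentiable_continuous.
  exact: cvg_at_left_filter.
- apply/gt0_cvgMlNy; last exact: cvg_addrr_Ny.
  by rewrite invr_gt0.
- apply: continuous_subspaceT.
  exact/continuous_normal_pdf/oner_neq0.
- by move=> z _; exact: normal_pdf_ge0.
Qed.

(* Completing the square. *)
Lemma normal_pdfM (a w x z : R) : a != 0 -> w != 0 ->
  let c := Num.sqrt (a ^+ 2 + w ^+ 2) in
  normal_pdf 0 a x * normal_pdf x w z =
  normal_pdf 0 c z * normal_pdf (z * a ^+ 2 / c ^+ 2) (a * w / c) x.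
Proof.
move=> a0 w0 c.
have a2 : 0 < a ^+ 2 by rewrite exprn_even_gt0.
have w2 : 0 < w ^+ 2 by rewrite exprn_even_gt0.
have c2 : c ^+ 2 = a ^+ 2 + w ^+ 2 by rewrite sqr_sqrtr// ltW// addr_gt0.
have c0 : c != 0 by rewrite gt_eqF// sqrtr_gt0 addr_gt0.
rewrite !normal_pdfE ?mulf_neq0 ?invr_eq0//= mulrACA [RHS]mulrACA.
congr (_ * _).
- rewrite /normal_peak -!invfM; congr (_^-1).
  have pos (u : R) : 0 <= u ^+ 2 * pi *+ 2.
    by rewrite mulrn_wge0// mulr_ge0 ?pi_ge0// sqr_ge0.
  rewrite -!sqrtrM//.
  congr Num.sqrt.
  field.
  done.
- rewrite /normal_fun -!expRD; congr expR.
  move: c2; clearbody c.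
  have c20 : a ^+ 2 + w ^+ 2 != 0 by rewrite gt_eqF// addr_gt0.
  rewrite !exprMn exprVn => ->.
  field.
  by rewrite c20 w0 a0.
Qed.

Lemma normal_prob_halfline (t x w : R) : w != 0 ->
  normal_prob 0 1 [set y | x + w * y <= t] = normal_prob x `|w| `]-oo, t].
Proof.
move=> w0; rewrite -normal_prob_affine ?normr_gt0//.
have [w_gt0|w_lt0|/eqP] := ltgtP 0 w; last by rewrite eq_sym (negbTE w0).
- rewrite gtr0_norm//; congr (normal_prob 0 1); apply/seteqP; split => y /=;
    by rewrite in_itv/= ler_pdivlMr// lerBrDl mulrC.
(* A negative [w] turns the event into a right ray; symmetry brings it back to a left ray. *)
- rewrite ltr0_norm// -[X in `]-oo, X]]opprK -normal_probN_ge.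
  congr (normal_prob 0 1); apply/seteqP; split => y /=;
    by rewrite in_itv/= andbT invrN mulrN opprK ler_ndivrMr// lerBrDl mulrC.
Qed.

Lemma measurable_normal_pdf2 w : w != 0 ->
  measurable_fun [set: R * R] (fun p => normal_pdf p.1 w p.2).
Proof.
move=> w0; under eq_fun do rewrite normal_pdfE//.
apply: measurable_funM => //; rewrite /normal_fun.
apply: measurableT_comp => //; apply: measurable_funM => //.
apply: measurableT_comp => //; apply: measurable_funX.
exact: measurable_funB.
Qed.

Lemma integral_setE (D : set R) (f : R -> R) :
  (\int[mu]_(x in D) (f x)%:E = \int[mu]_x (f x * \1_D x)%:E)%E.
Proof.
rewrite integral_mkcond; apply: eq_integral => x _.
by rewrite patchE indicE; case: ifP; rewrite ?mulr1 ?mulr0.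
Qed.

(** Given the first coordinate [x], the section is a half-line of mass [normal_prob x |w|]. Tonelli
    puts the integral over [x] inside, and by [normal_pdfM] it runs over a full normal density,
    which leaves the density of deviation [c]. *)
Lemma normal_prob_conv (a w t : R) : a != 0 -> w != 0 ->
  (normal_prob 0 a \x normal_prob 0 1)%E [set p : R * R | p.1 + w * p.2 <= t] =
  normal_prob 0 (Num.sqrt (a ^+ 2 + w ^+ 2)) `]-oo, t].
Proof.
move=> a0 w0; set A := [set p | _]; set c := Num.sqrt _.
have mA : measurable A.
  rewrite /A -[X in measurable X]setTI.
  apply: (measurable_fun_le (f := fun p : R * R => p.1 + w * p.2) (g := cst t)) => //.
  by apply: measurable_funD => //; apply: measurable_funM.
have xsA x : xsection A x = [set y | x + w * y <= t].
  by apply/seteqP; split => y; rewrite /xsection/= inE.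
rewrite /product_measure1 integral_normal_prob; last first.
  apply: le_integrable (finite_measure_integrable_cst _ 1 measurableT) => //.
    exact: measurable_fun_xsection.
  move=> x _ /=; rewrite normr1 gee0_abs ?measure_ge0//.
  by apply: probability_le1; exact: measurable_xsection.
pose f (p : R * R) :=
  (normal_pdf 0 a p.1 * normal_pdf p.1 `|w| p.2 * \1_(`]-oo, t]) p.2)%:E.
have f0 p : (0 <= f p)%E.
  by rewrite lee_fin !mulr_ge0 ?normal_pdf_ge0// indicE.
have mf : measurable_fun [set: R * R] f.
  apply/measurable_EFinP; apply: measurable_funM.
    apply: measurable_funM; last by apply: measurable_normal_pdf2; rewrite normr_eq0.
    by apply: (measurableT_comp (measurable_normal_pdf 0 a)).
  have mI : measurable_fun [set: R] (\1_(`]-oo, t]%classic : set R) : R -> R).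
    exact: measurable_indic.
  exact: (measurableT_comp mI measurable_snd).
transitivity (\int[mu]_x \int[mu]_y f (x, y))%E.
  apply: eq_integral => x _; rewrite /= xsA normal_prob_halfline//.
  rewrite /normal_prob integral_setE -ge0_integralZr//=.
  - by apply: eq_integral => y _; rewrite /f/= -EFinM; congr EFin; rewrite mulrC mulrA.
  - apply/measurable_EFinP; apply: measurable_funM => //.
    exact: measurable_normal_pdf.
  - by move=> y _; rewrite lee_fin mulr_ge0 ?normal_pdf_ge0// indicE.
  - by rewrite lee_fin normal_pdf_ge0.
rewrite (fubini_tonelli (m1 := mu) (m2 := mu))//.
rewrite /normal_prob integral_setE; apply: eq_integral => z _.
under eq_integral.
  move=> x _; rewrite /f/= normal_pdfM ?normr_eq0// real_normK ?num_real// -/c.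
  rewrite mulrAC EFinM; over.
rewrite ge0_integralZl//=.
- by rewrite integral_normal_pdf mule1.
- by apply/measurable_EFinP; exact: measurable_normal_pdf.
- by move=> x _; rewrite lee_fin normal_pdf_ge0.
- by rewrite lee_fin mulr_ge0 ?normal_pdf_ge0// indicE.
Qed.

End normal_sum.

(** * Joint laws of independent variables *)

Section joint_law.
Context {R : realType} {dT : measure_display} {T : measurableType dT}.
Variable P : probability T R.

(** Uniqueness of the product measure, applied to [P] restricted to [E]; the factor [P E] is
    absorbed by scaling the second marginal. Keeping [E] lets the independence of later variables
    pass through an induction. *)
Lemma joint_law (X Y : {RV P >-> R}) (E : set T) : measurable E ->
  (forall A B : set R, measurable A -> measurable B ->
    P ((X @^-1` A `&` Y @^-1` B) `&` E) =
      (P (X @^-1` A) * P (Y @^-1` B) * P E)%E) ->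
  forall D : set (R * R), measurable D ->
    P ([set t | D (X t, Y t)] `&` E) =
      ((distribution P X \x distribution P Y) D * P E)%E.
Proof.
move=> mE indep D mD.
have mXY : measurable_fun [set: T] (fun t => (X t, Y t)).
  exact: measurable_fun_pair.
have c0 : 0 <= fine (P E) by rewrite fine_ge0.
pose c := NngNum c0.
have cE : c%:num%:E = P E by rewrite /= fineK// fin_num_measure.
pose m' := pushforward (mrestr P mE) (fun t => (X t, Y t)).
have /(_ mXY) h := @product_measure_unique _ _ _ _ _
  (distribution P X) (mscale c (distribution P Y)) m'.
transitivity ((distribution P X \x mscale c (distribution P Y))%E D).
  apply/esym/h => // A B mA mB; rewrite /mscale cE.
  transitivity (P ((X @^-1` A `&` Y @^-1` B) `&` E)); first by [].
  by rewrite indep// muleAC -muleA; congr (_ * _)%E; rewrite /=; congr (_ * _)%E.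
rewrite /product_measure1 -ge0_integralZr//; last exact: measurable_fun_xsection.
by apply: eq_integral => x _; rewrite /= /mscale cE muleC.
Qed.

(* [R] and [measurableTypeR R] have the same measurable sets but are different
   measurable types: random variables take values in the former, [normal_prob]
   is a measure on the latter. *)
Lemma eq_law_itvNyc (X : {RV P >-> R}) (Q : probability (measurableTypeR R) R) :
  (forall t : R, P (X @^-1` `]-oo, t]) = Q `]-oo, t]%classic) ->
  forall A : set R, measurable A -> P (X @^-1` A) = Q A.
Proof.
move=> PQ.
have mX : measurable_fun [set: T] (X : T -> measurableTypeR R).
  move=> mT A mA; exact: (measurable_funPT X mT A mA).
pose X' : {mfun T >-> measurableTypeR R} :=
  HB.pack (X : T -> measurableTypeR R) (isMeasurableFun.Build _ _ _ _ _ mX).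
exact: (eq_probability_itvNyc (distribution P X') Q).
Qed.

Lemma integral_eq_law (X : {RV P >-> R}) (Q : probability (measurableTypeR R) R) :
  (forall A : set R, measurable A -> P (X @^-1` A) = Q A) ->
  forall f : R -> \bar R, measurable_fun [set: R] f -> (forall x, 0 <= f x)%E ->
  (\int[distribution P X]_x f x = \int[Q]_x f x)%E.
Proof.
move=> PQ f mf f0.
(* The identity, seen as a measurable map between the two types, transports [Q]. *)
pose idR : measurableTypeR R -> R := id.
have midR : measurable_fun [set: measurableTypeR R] idR.
  by move=> mT A mA; rewrite setTI.
transitivity (\int[pushforward Q idR]_x f x)%E; last first.
  by rewrite (ge0_integral_pushforward midR).
by apply: (@eq_measure_integral _ R R setT) => A mA _; exact: PQ.
Qed.

End joint_law.

(** * The law of a weighted sum of independent standard normals *)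

Section weighted_sum.
Context {R : realType} {dT : measure_display} {T : measurableType dT}.
Variables (P : probability T R) (n : nat) (Z : 'I_n -> {RV P >-> R}).
Variable w : 'I_n -> R.

Definition wsum (k : nat) (t : T) : R := \sum_(i < n | (i < k)%N) w i * Z i t.

Lemma measurable_wsum k : measurable_fun [set: T] (wsum k).
Proof.
rewrite (_ : wsum k = fun t => \sum_(i < n) (if (i < k)%N then w i * Z i t else 0)).
  apply: measurable_sum => i; case: (i < k)%N => //.
  exact: measurable_funM.
by apply/funext => t; rewrite /wsum big_mkcond.
Qed.

HB.instance Definition _ k :=
  isMeasurableFun.Build _ _ _ _ (wsum k) (measurable_wsum k).

(** The variables that [wsum k] has not yet consumed; independence from these events is the
    invariant of the induction on [k]. *)
Definition tail_event (k : nat) (C : 'I_n -> set R) : set T :=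
  \bigcap_(i in [set i : 'I_n | (k <= i)%N]) Z i @^-1` C i.

Lemma measurable_tail_event k C : (forall i, measurable (C i)) ->
  measurable (tail_event k C).
Proof.
move=> mC; apply: fin_bigcap_measurable => // i _.
by rewrite -[X in measurable X]setTI; exact: measurable_funP.
Qed.

Hypothesis indZ : mutually_independent Z.

Lemma prob_tail_event k C : (forall i, measurable (C i)) ->
  P (tail_event k C) = (\prod_(i < n | (k <= i)%N) P (Z i @^-1` C i))%E.
Proof.
move=> mC.
(* Padding with the full line below [k] makes the product rule for the whole family applicable. *)
pose C' (i : 'I_n) := if (k <= i)%N then C i else setT.
have mC' i : measurable (C' i) by rewrite /C'; case: ifP.
have -> : tail_event k C = \bigcap_(i in [set: 'I_n]) Z i @^-1` C' i.
  apply/seteqP; split => t h i /= ki; rewrite /C'.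
    by case: ifP => // ki'; exact: h.
  by have := h i Logic.I; rewrite /= /C' ki.
rewrite indZ// [RHS]big_mkcond; apply: eq_bigr => i _.
by rewrite /C'; case: ifP => // _; rewrite preimage_setT probability_setT.
Qed.

Lemma wsumS (i : 'I_n) t : wsum i.+1 t = wsum i t + w i * Z i t.
Proof.
rewrite /wsum (bigD1 i)//= addrC; congr (_ + _).
by apply: eq_bigl => j; rewrite ltnS ltn_neqAle andbC.
Qed.

Lemma tail_eventS (i : 'I_n) C : tail_event i C = Z i @^-1` C i `&` tail_event i.+1 C.
Proof.
apply/seteqP; split => t /=.
  by move=> h; split => [|j /= ij]; apply: h => //=; exact: ltnW.
move=> [hi h] j /=; rewrite leq_eqVlt => /orP[/eqP/val_inj <-//|]; exact: h.
Qed.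

Lemma prob_tail_eventS (i : 'I_n) C : (forall i, measurable (C i)) ->
  P (tail_event i C) = (P (Z i @^-1` C i) * P (tail_event i.+1 C))%E.
Proof.
move=> mC; rewrite !prob_tail_event// (bigD1 i)//=; congr (_ * _)%E.
by apply: eq_bigl => j; rewrite ltn_neqAle eq_sym andbC.
Qed.

Let addw (i : 'I_n) (A : set R) : set (R * R) := [set p | A (p.1 + w i * p.2)].

Let measurable_addw i A : measurable A -> measurable (addw i A).
Proof.
move=> mA; rewrite -[X in measurable X]setTI.
have : measurable_fun [set: R * R] (fun p : R * R => p.1 + w i * p.2).
  by apply: measurable_funD => //; apply: measurable_funM.
exact.
Qed.

Let preimage_wsumS (i : 'I_n) A :
  wsum i.+1 @^-1` A = [set t | addw i A (wsum i t, Z i t)].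
Proof. by apply/seteqP; split => t; rewrite /addw /= wsumS. Qed.

(** On a rectangle, the condition on [Z i] merges with the later ones into one tail event starting
    at [i], where the assumed independence applies; [joint_law] then passes to all measurable sets
    of pairs. *)
Let joint_step (i : 'I_n) :
  (forall A C, measurable A -> (forall i, measurable (C i)) ->
    P (wsum i @^-1` A `&` tail_event i C) =
    (P (wsum i @^-1` A) * P (tail_event i C))%E) ->
  forall D C, measurable D -> (forall i, measurable (C i)) ->
    P ([set t | D (wsum i t, Z i t)] `&` tail_event i.+1 C) =
    ((distribution P (wsum i) \x distribution P (Z i)) D
     * P (tail_event i.+1 C))%E.
Proof.
move=> IH D C mD mC; apply: joint_law => //; first exact: measurable_tail_event.
move=> A B mA mB.
pose C' (j : 'I_n) := if j == i then B else C j.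
have mC' j : measurable (C' j) by rewrite /C'; case: ifP.
have tC' : tail_event i.+1 C = tail_event i.+1 C'.
  apply: eq_bigcapr => j /= ij; rewrite /C' ifF//.
  by apply/negbTE; move: ij; apply: contraTneq => ->; rewrite ltnn.
have C'i : C' i = B by rewrite /C' eqxx.
by rewrite tC' -{1 2}C'i -setIA -tail_eventS IH// prob_tail_eventS// muleA.
Qed.

(** Induction on [k]: the next partial sum is a function of the pair of [wsum k] and the next
    variable, whose joint law splits off the remaining tail. *)
Lemma wsum_indep_tail k : (k <= n)%N ->
  forall A C, measurable A -> (forall i, measurable (C i)) ->
    P (wsum k @^-1` A `&` tail_event k C) =
    (P (wsum k @^-1` A) * P (tail_event k C))%E.
Proof.
elim: k => [_ A C mA mC|k IH kn A C mA mC].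
  have -> : wsum 0 = cst 0 by apply/funext => t; rewrite /wsum big_pred0.
  rewrite preimage_cst; case: ifP => _.
    by rewrite setTI probability_setT mul1e.
  by rewrite set0I measure0 mul0e.
pose i := Ordinal kn.
have IHi := IH (ltnW kn).
have joint := @joint_step i IHi (addw i A).
have mT (j : 'I_n) : measurable [set: R] by [].
rewrite -[k]/(nat_of_ord i) preimage_wsumS joint//; last exact: measurable_addw.
(* With trivial conditions on the tail, the same identity evaluates the law of the next sum
   itself. *)
have := joint (fun=> setT) (measurable_addw i A mA) mT.
have -> : tail_event i.+1 (fun=> setT) = setT.
  by apply/seteqP; split => t // _ j _.
by rewrite setIT probability_setT mule1 => <-.
Qed.

Lemma wsumS_law (i : 'I_n) A : measurable A ->
  P (wsum i.+1 @^-1` A) =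
  (distribution P (wsum i) \x distribution P (Z i))%E
    [set p | A (p.1 + w i * p.2)].
Proof.
move=> mA; rewrite preimage_wsumS.
have := @joint_step i (wsum_indep_tail _ (ltnW (ltn_ord i))) (addw i A) (fun=> setT).
have -> : tail_event i.+1 (fun=> setT) = setT.
  by apply/seteqP; split => t // _ j _.
rewrite setIT probability_setT mule1 => -> //.
exact: measurable_addw.
Qed.

Hypothesis normZ : forall i, std_normal_rv (Z i).

(* The variance has to be nonzero: [normal_prob 0 0] is by convention the uniform
   law on [0, 1], not a Dirac mass. *)
Lemma wsum_law k : (k <= n)%N -> let v := \sum_(i < n | (i < k)%N) w i ^+ 2 in
  v != 0 ->
  forall A, measurable A -> P (wsum k @^-1` A) = normal_prob 0 (Num.sqrt v) A.
Proof.
elim: k => [_|k IH kn] v; first by rewrite /v big_pred0// eqxx.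
pose i := Ordinal kn.
pose u := \sum_(j < n | (j < k)%N) w j ^+ 2.
have u0 : 0 <= u by apply: sumr_ge0 => j _; exact: sqr_ge0.
have vE : v = u + w i ^+ 2.
  rewrite /v (bigD1 i)//= addrC; congr (_ + _).
  by apply: eq_bigl => j; rewrite ltnS ltn_neqAle andbC.
have [wi0|wi0] := eqVneq (w i) 0.
  have uv : v = u by rewrite vE wi0 expr0n addr0.
  rewrite uv => u_neq0 A mA; rewrite -IH//; last exact: ltnW.
  congr (P _); apply/seteqP; split => t /=;
    by rewrite -[k.+1]/(i.+1) wsumS wi0 mul0r addr0.
move=> _ A mA.
apply: eq_law_itvNyc mA => t.
(* If the variance so far is zero, the sum is just [w i * Z i]; this case is separate because the
   convolution formula needs a nonzero deviation. *)
have [u_eq0|u_neq0] := eqVneq u 0.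
  have w0 (j : 'I_n) : (j < k)%N -> w j = 0.
    move=> jk; apply/eqP; rewrite -sqrf_eq0; apply/eqP.
    by apply: (@psumr_eq0P _ _ (fun j : 'I_n => (j < k)%N) (fun j => w j ^+ 2) _ u_eq0 j jk) => ? _;
      exact: sqr_ge0.
  have -> : wsum k.+1 @^-1` `]-oo, t] = Z i @^-1` [set y | 0 + w i * y <= t].
    apply/seteqP; split => x /=; rewrite -[k.+1]/(i.+1) wsumS in_itv/=;
      by rewrite /wsum big1// => j /w0 ->; rewrite mul0r.
  rewrite -[LHS]/(distribution P (Z i) _) normZ normal_prob_halfline//.
  by rewrite vE u_eq0 add0r sqrtr_sqr.
rewrite -[k.+1]/(i.+1) wsumS_law// normZ vE -[X in Num.sqrt (X + _)]sqr_sqrtr//.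
transitivity ((normal_prob 0 (Num.sqrt u) \x normal_prob 0 1)%E
  [set p : R * R | p.1 + w i * p.2 <= t]); last first.
  by apply: normal_prob_conv => //; rewrite sqrtr_eq0 -ltNge lt0r u_neq0.
have -> : [set p : R * R | `]-oo, t]%classic (p.1 + w i * p.2)] =
    [set p : R * R | p.1 + w i * p.2 <= t].
  by apply/seteqP; split => p /=; rewrite in_itv.
(* Only the outer law still differs, and by induction the partial sum is normal with variance
   [u]. *)
rewrite /product_measure1; apply: integral_eq_law => //.
- by move=> B mB; apply: IH => //; exact: ltnW.
- apply: measurable_fun_xsection.
  have := measurable_addw i _ (measurable_itv `]-oo, t]).
  rewrite /addw; congr measurable; apply/seteqP; split => p /=; by rewrite in_itv.
Qed.

End weighted_sum.

(** * The one-dimensional threshold problem and the disparity at its minimum *)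

Section one_dim.
Context {R : realType}.
Variable sigma : R.
Hypothesis sigma_gt1 : 1 < sigma.
Implicit Types (a u x y : R).
Local Notation phi := (normal_pdf (0 : R) 1).
Local Notation h := (h_fun sigma).

Let sigma_gt0 : 0 < sigma. Proof. exact: lt_trans ltr01 _. Qed.
Let sigma_neq0 : sigma != 0. Proof. by rewrite gt_eqF. Qed.
Let sigma2_gt1 : 0 < sigma ^+ 2 - 1. Proof. by rewrite subr_gt0 expr_gt1// ltW. Qed.
Let ln_gt0 : 0 < ln sigma. Proof. exact: ln_gt0. Qed.

Lemma h_fun_gt0 : 0 < h.
Proof. by rewrite /h_fun divr_gt0// !mulr_gt0// exprn_gt0. Qed.

(** For [a = A * g] this is the root in the lower end of the interval; divided by [sigma], it is the
    root in the upper end. *)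
Definition crit_sqrt a := Num.sqrt (a ^+ 2 + h).

Lemma crit_sqrtK a : crit_sqrt a ^+ 2 = a ^+ 2 + h.
Proof. by rewrite sqr_sqrtr// addr_ge0 ?sqr_ge0// ltW// h_fun_gt0. Qed.

Lemma crit_sqrt_gt a : `|a| < crit_sqrt a.
Proof.
rewrite -sqrtr_sqr ltr_sqrt; first by rewrite ltrDl h_fun_gt0.
by rewrite ltr_wpDl ?sqr_ge0// h_fun_gt0.
Qed.

Lemma crit_sqrt_gt0 a : 0 < crit_sqrt a.
Proof. exact: le_lt_trans (normr_ge0 a) (crit_sqrt_gt a). Qed.

(** Writing [sigma] as [expR (ln sigma)] reduces the comparison to exponents, whose difference is
    half of the right-hand expression. *)
Lemma normal_pdf_ratio x y :
  phi x / sigma < phi y = (0 < x ^+ 2 + 2 * ln sigma - y ^+ 2).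
Proof.
rewrite !normal_pdfE ?oner_neq0// -mulrA ltr_pM2l ?normal_peak_gt0 ?oner_neq0//.
rewrite -{1}(lnK sigma_gt0) -expRN -expRD ltr_expR !subr0 expr1n.
rewrite -[in RHS](pmulr_rgt0 _ (_ : 0 < 2^-1)) ?invr_gt0// -subr_gt0.
by congr (0 < _); field.
Qed.

Lemma normal_pdf_ratio_eq x y :
  phi x / sigma = phi y -> x ^+ 2 + 2 * ln sigma - y ^+ 2 = 0.
Proof.
rewrite !normal_pdfE ?oner_neq0// -mulrA => /(mulfI (lt0r_neq0 (normal_peak_gt0 (oner_neq0 R)))).
rewrite -{1}(lnK sigma_gt0) -expRN -expRD !subr0 expr1n => /expR_inj.
move=> e; lra.
Qed.

(* Twice the total error of the classifier with equal weights: [a] is [A * g],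
   and [u] is the signed distance from the mean of the negative class, shifted
   by the worst perturbation, to the decision boundary. *)
Definition thr_err a u := Phi (u / sigma - a * (1 - sigma ^- 2)) + Phi (- u).

Lemma is_derive_thr_err a u : is_derive u 1 (thr_err a)
  (phi (u / sigma - a * (1 - sigma ^- 2)) / sigma - phi u).
Proof.
have d1 : is_derive u 1 (fun u : R => u / sigma - a * (1 - sigma ^- 2)) sigma^-1.
  by apply: is_derive_eq; rewrite !scaler0 add0r subr0 /GRing.scale/= mulr1.
have d2 : is_derive u 1 (fun u : R => - u) (-1) by apply: is_derive_eq.
have p1 := @is_derive1_comp R Phi _ u _ _ (is_derive_Phi _) d1.
have p2 := @is_derive1_comp R Phi _ u _ _ (is_derive_Phi _) d2.
have := is_deriveD p1 p2.
congr is_derive.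
rewrite mulrN1; congr (_ - _).
by rewrite !normal_pdfE ?oner_neq0// /normal_fun !subr0 sqrrN.
Qed.

(* The two factors are the critical points of [thr_err a]. *)
Let gap a u : (u / sigma - a * (1 - sigma ^- 2)) ^+ 2 + 2 * ln sigma - u ^+ 2 =
  - (1 - sigma ^- 2) * ((u - (crit_sqrt a - a / sigma)) * (u - (- crit_sqrt a - a / sigma))).
Proof.
have -> : (u - (crit_sqrt a - a / sigma)) * (u - (- crit_sqrt a - a / sigma)) =
  (u + a / sigma) ^+ 2 - crit_sqrt a ^+ 2 by ring.
rewrite crit_sqrtK /h_fun; field.
by rewrite sigma_neq0 gt_eqF.
Qed.

(** The derivative vanishes at a minimum, so [u] is one of the two roots in [gap]. Between the roots
    [gap] is positive and [thr_err a] strictly decreases, which excludes the smaller one. *)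
Lemma thr_err_min a u : (forall v, thr_err a u <= thr_err a v) ->
  u = crit_sqrt a - a / sigma.
Proof.
move=> umin.
have c0 : 0 < 1 - sigma ^- 2 by rewrite subr_gt0 invf_lt1 ?exprn_gt0// expr_gt1// ltW.
have [_ d0] : is_derive u 1 (thr_err a) 0.
  apply: (@derive1_at_min _ _ (u - 1) (u + 1)).
  - lra.
  - by move=> t _; have [] := is_derive_thr_err a t.
  - by rewrite in_itv/=; apply/andP; split; lra.
  - by move=> t _; exact: umin.
have [_ d1] := is_derive_thr_err a u.
have /normal_pdf_ratio_eq : phi (u / sigma - a * (1 - sigma ^- 2)) / sigma = phi u.
  by apply/eqP; rewrite -subr_eq0 -d1 d0.
rewrite gap => /eqP; rewrite mulf_eq0 oppr_eq0 (gt_eqF c0)/= mulf_eq0 !subr_eq0.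
move=> /orP[/eqP //|/eqP uE].
have S0 := crit_sqrt_gt0 a.
have : thr_err a (crit_sqrt a - a / sigma) < thr_err a u.
  apply: (@ltr0_derive1_lt_cc R (thr_err a) u (crit_sqrt a - a / sigma)).
  - by move=> t _; have [] := is_derive_thr_err a t.
  - move=> t; rewrite in_itv/= => /andP[t1 t2].
    have [_ dt] := is_derive_thr_err a t.
    rewrite derive1E dt subr_lt0 normal_pdf_ratio gap mulNr -mulrN pmulr_rgt0//.
    by rewrite -mulNr mulr_gt0//; lra.
  - by apply: derivable_within_continuous => t _; have [] := is_derive_thr_err a t.
  - by rewrite in_itv/= lexx; lra.
  - by rewrite in_itv/= lexx; lra.
  - lra.
by rewrite ltNge umin.
Qed.

Definition disp_fun a := Phi (crit_sqrt a / sigma - a) - Phi (a / sigma - crit_sqrt a).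

Lemma is_derive_crit_sqrt a : is_derive a 1 crit_sqrt (a / crit_sqrt a).
Proof.
have d1 : is_derive a 1 (fun a : R => a ^+ 2 + h) (2 * a).
  apply: is_derive_eq; rewrite /GRing.scale/= addr0 mulr1; ring.
have h0 : 0 < a ^+ 2 + h by rewrite ltr_wpDl ?sqr_ge0// h_fun_gt0.
have := @is_derive1_comp R Num.sqrt _ a _ _ (is_derive1_sqrt h0) d1.
congr is_derive.
have := crit_sqrt_gt0 a; rewrite /crit_sqrt => s0.
by field; rewrite gt_eqF.
Qed.

(** At the larger root [gap] vanishes, which is equality of the exponents once [sigma] is written as
    an exponential. *)
Lemma crit_pdf a : phi (crit_sqrt a / sigma - a) = sigma * phi (a / sigma - crit_sqrt a).
Proof.
have := gap a (crit_sqrt a - a / sigma).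
rewrite subrr mul0r mulr0.
have -> : (crit_sqrt a - a / sigma) / sigma - a * (1 - sigma ^- 2) = crit_sqrt a / sigma - a.
  by field.
move=> e.
rewrite !normal_pdfE ?oner_neq0// mulrCA; congr (_ * _).
rewrite -[X in X * expR _](lnK sigma_gt0) -expRD; congr expR.
rewrite !subr0 expr1n -(sqrrN (a / sigma - _)) opprB.
lra.
Qed.

(* By [crit_pdf] the derivatives of both terms are multiples of the same density
   value. *)
Lemma disp_fun_decr : {homo disp_fun : a1 a2 /~ a1 < a2}.
Proof.
have dK a : is_derive a 1 disp_fun
    (phi (a / sigma - crit_sqrt a) * (2 * (a / crit_sqrt a) - sigma - sigma^-1)).
  have dS := is_derive_crit_sqrt a.
  have d1 : is_derive a 1 (fun a => crit_sqrt a / sigma - a) (a / crit_sqrt a / sigma - 1).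
    by apply: is_derive_eq; rewrite !scaler0 add0r /GRing.scale/= mulrC.
  have d2 : is_derive a 1 (fun a => a / sigma - crit_sqrt a) (sigma^-1 - a / crit_sqrt a).
    by apply: is_derive_eq; rewrite !scaler0 add0r /GRing.scale/= mulr1.
  have := is_deriveB (@is_derive1_comp R Phi _ a _ _ (is_derive_Phi _) d1)
    (@is_derive1_comp R Phi _ a _ _ (is_derive_Phi _) d2).
  congr is_derive.
  rewrite crit_pdf; field.
  by rewrite sigma_neq0 gt_eqF// crit_sqrt_gt0.
move=> a2 a1 a12; apply: (@ltr0_derive1_lt_cc R disp_fun a1 a2).
- by move=> t _; have [] := dK t.
- move=> t _; have [_ dt] := dK t.
  rewrite derive1E dt pmulr_rlt0 ?normal_pdf_gt0 ?oner_neq0//.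
  have t1 : t / crit_sqrt t < 1.
    rewrite ltr_pdivrMr ?crit_sqrt_gt0// mul1r.
    exact: le_lt_trans (ler_norm _) (crit_sqrt_gt t).
  (* Strict inequality of means, as [sigma] differs from 1. *)
  have s2 : 2 < sigma + sigma^-1.
    rewrite -subr_gt0 (_ : _ - 2 = (sigma - 1) ^+ 2 / sigma); last by field.
    by rewrite divr_gt0// exprn_gt0// subr_gt0.
  lra.
- by apply: derivable_within_continuous => t _; have [] := dK t.
- by rewrite in_itv/= lexx ltW.
- by rewrite in_itv/= lexx ltW.
- by [].
Qed.

Lemma disparity_formulaE n g :
  disparity_formula n sigma g = disp_fun (A_const n sigma * g).
Proof.
rewrite /disparity_formula /disp_fun.
move: (A_const n sigma) => A /=; set a := A * g.
have -> : A ^+ 2 * g ^+ 2 + h_fun sigma = a ^+ 2 + h by rewrite /a exprMn.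
have -> : Num.sqrt ((A / sigma) ^+ 2 * g ^+ 2 + h_fun sigma / sigma ^+ 2) =
    crit_sqrt a / sigma.
  rewrite (_ : _ + _ = (a ^+ 2 + h) * sigma^-1 ^+ 2); last by rewrite /a; field.
  by rewrite sqrtrM ?sqrtr_sqr ?ger0_norm ?invr_ge0 ?(ltW sigma_gt0)//
    addr_ge0 ?sqr_ge0// ltW// h_fun_gt0.
rewrite (_ : A / sigma * g = a / sigma); last by rewrite /a mulrAC.
rewrite -/(crit_sqrt a) [- a + _]addrC std_normal_intervalE//.
have aS : a < crit_sqrt a := le_lt_trans (ler_norm _) (crit_sqrt_gt a).
(* The endpoints must be in order for the mass of the interval to be a difference of values of
   [Phi]. *)
rewrite -subr_ge0.
rewrite (_ : crit_sqrt a / sigma - a - _ = (crit_sqrt a - a) * (1 + sigma^-1)); last by ring.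
by rewrite mulr_ge0 ?subr_ge0 ?(ltW aS)// addr_ge0// invr_ge0 ltW.
Qed.

End one_dim.

(** * Comparison of the sums of a unit vector with the root of the dimension *)

Section l1_l2.
Context {R : realType}.
Variables (n : nat) (w : 'I_n -> R).

Lemma sum_le_l1 : \sum_(i < n) w i <= \sum_(i < n) `|w i|.
Proof. by apply: ler_sum => i _; exact: ler_norm. Qed.

Lemma unit_l2_dim_gt0 : unit_l2 w -> (0 < n)%N.
Proof.
rewrite /unit_l2; case: n w => // w'; rewrite big_ord0 => /eqP.
by rewrite eq_sym oner_eq0.
Qed.

(** Cauchy-Schwarz against the all-ones vector: with [r] the root of [n] and [L] the left side, the
    sum of the squares [(|w i| * r - 1) ^+ 2] equals [2 * r * (r - L)]. *)
Lemma unit_l1_le : unit_l2 w -> \sum_(i < n) `|w i| <= Num.sqrt n%:R.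
Proof.
move=> w1; have n0 := unit_l2_dim_gt0 w1.
set L := \sum_(i < n) _; set r := Num.sqrt _.
have r0 : 0 < r by rewrite sqrtr_gt0 ltr0n.
have r2 : r ^+ 2 = n%:R by rewrite sqr_sqrtr// ler0n.
have : 0 <= \sum_(i < n) (`|w i| * r - 1) ^+ 2.
  by apply: sumr_ge0 => i _; exact: sqr_ge0.
under eq_bigr => i _.
  rewrite (_ : _ ^+ 2 = r ^+ 2 * w i ^+ 2 - 2 * r * `|w i| + 1); last first.
    by rewrite -(real_normK (num_real (w i))); ring.
  over.
rewrite !big_split/= sumrN -!mulr_sumr w1 -/L sumr_const card_ord r2.
rewrite -mulr_natl -r2 => H.
have : 0 <= 2 * r * (r - L) by lra.
by rewrite pmulr_rge0 ?subr_ge0// mulr_gt0.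
Qed.

End l1_l2.

(** * Conditional errors as values of [Phi] *)

Section errors.
Context {R : realType} {dT : measure_display} {T : measurableType dT}.
Variables (P : probability T R) (n : nat) (Z : 'I_n -> {RV P >-> R}).
Hypotheses (normZ : forall i, std_normal_rv (Z i)) (indZ : mutually_independent Z).
Implicit Types (w : 'I_n -> R) (b m s eps : R).

Lemma unit_wsum_law w (A : set R) : unit_l2 w -> measurable A ->
  P [set t | A (\sum_(i < n) w i * Z i t)] = normal_prob 0 1 A.
Proof.
move=> w1 mA.
have w1' : \sum_(i < n | (i < n)%N) w i ^+ 2 = 1.
  by rewrite -[RHS]w1; apply: eq_bigl => i; rewrite ltn_ord.
have := wsum_law P n Z w indZ normZ n (leqnn n).
rewrite /= w1' sqrtr1 => /(_ (oner_neq0 R) A mA) <-.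
congr (P _); apply/funext => t /=; rewrite /wsum/=; congr (A _).
by apply: eq_bigl => i; rewrite ltn_ord.
Qed.

Lemma sum_gauss_pt w m s t : \sum_(i < n) w i * gauss_pt Z m s t i =
  m * \sum_(i < n) w i + s * \sum_(i < n) w i * Z i t.
Proof.
rewrite !mulr_sumr -big_split/=; apply: eq_bigr => i _.
by rewrite /gauss_pt; ring.
Qed.

Lemma perturb_bound w (delta : 'I_n -> R) eps : (forall i, `|delta i| <= eps) ->
  `|\sum_(i < n) w i * delta i| <= eps * \sum_(i < n) `|w i|.
Proof.
move=> de; apply: le_trans (ler_norm_sum _ _ _) _; rewrite mulr_sumr.
by apply: ler_sum => i _; rewrite normrM mulrC ler_wpM2r.
Qed.

Lemma perturb_attain w eps : 0 <= eps ->
  let delta i := eps * Num.sg (w i) in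
  (forall i, `|delta i| <= eps) /\
  \sum_(i < n) w i * delta i = eps * \sum_(i < n) `|w i|.
Proof.
move=> e0 delta; split=> [i|].
  rewrite /delta normrM ger0_norm// normr_sg ler_piMr//.
  by case: (_ != 0); rewrite ?lexx ?ler01.
rewrite mulr_sumr; apply: eq_bigr => i _.
by rewrite /delta mulrCA [w i * _]mulrC -normrEsg.
Qed.

Lemma lin_clf_neq1 w b x : (lin_clf w b x != 1) = (\sum_(i < n) w i * x i + b < 0).
Proof.
rewrite /lin_clf; case: leP => _; first by rewrite eqxx.
by apply/eqP; lra.
Qed.

Lemma lin_clf_neqN1 w b x : (lin_clf w b x != -1) = (0 <= \sum_(i < n) w i * x i + b).
Proof.
rewrite /lin_clf; case: leP => _; last by rewrite eqxx.
by apply/eqP; lra.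
Qed.

Lemma sum_perturb w (x delta : 'I_n -> R) :
  \sum_(i < n) w i * (x i + delta i) =
  \sum_(i < n) w i * x i + \sum_(i < n) w i * delta i.
Proof. by rewrite -big_split/=; apply: eq_bigr => i _; rewrite mulrDr. Qed.

(** An attack succeeds exactly when lowering the score by [eps] times the l1 norm makes it
    negative. *)
Lemma rob_err_pos w b m s eps : unit_l2 w -> 0 <= eps -> 0 < s ->
  rob_err Z eps m s 1 w b =
  Phi ((eps * \sum_(i < n) `|w i| - m * \sum_(i < n) w i - b) / s).
Proof.
move=> w1 e0 s0; rewrite /rob_err.
set c := _ / s.
rewrite (_ : [set t | _] = [set t | `]-oo, c[%classic (\sum_(i < n) w i * Z i t)]).
  by rewrite unit_wsum_law// normal_prob_itvNyo.
apply/seteqP; split => t /=; rewrite in_itv/= /c ltr_pdivlMr//.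
  move=> [delta [/(perturb_bound w)]].
  rewrite ler_norml lin_clf_neq1 sum_perturb sum_gauss_pt => /andP[d1 d2]; lra.
move=> h; have [d1 d2] := perturb_attain w eps e0.
(* The attack opposes the sign of each weight, to push the score down. *)
exists (fun i => - (eps * Num.sg (w i))); split; first by move=> i; rewrite normrN.
rewrite lin_clf_neq1 sum_perturb sum_gauss_pt.
under [X in _ + X + _]eq_bigr do rewrite mulrN.
by rewrite sumrN d2; lra.
Qed.

(** Here the attack raises the score. A score of 0 is classified as +1 and counts as an error, hence
    the closed ray; symmetry turns it into a value of [Phi]. *)
Lemma rob_err_neg w b m eps : unit_l2 w -> 0 <= eps ->
  rob_err Z eps m 1 (-1) w b =
  Phi (eps * \sum_(i < n) `|w i| + m * \sum_(i < n) w i + b).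
Proof.
move=> w1 e0; rewrite /rob_err.
set c := _ + b.
rewrite (_ : [set t | _] = [set t | `[- c, +oo[%classic (\sum_(i < n) w i * Z i t)]).
  by rewrite unit_wsum_law// normal_prob_itvcy opprK.
apply/seteqP; split => t /=; rewrite in_itv/= andbT /c.
  move=> [delta [/(perturb_bound w)]].
  rewrite ler_norml lin_clf_neqN1 sum_perturb sum_gauss_pt => /andP[d1 d2]; lra.
move=> h; have [d1 d2] := perturb_attain w eps e0.
exists (fun i => eps * Num.sg (w i)); split => //.
by rewrite lin_clf_neqN1 sum_perturb sum_gauss_pt d2; lra.
Qed.

Lemma nat_errE w b m s y : nat_err Z m s y w b = rob_err Z 0 m s y w b.
Proof.
rewrite /nat_err /rob_err; congr (fine (P _)); apply/seteqP; split => t /=.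
  move=> h; exists (fun=> 0); split => [i|]; first by rewrite normr0.
  by under eq_fun do rewrite addr0.
move=> [delta [d0]].
rewrite (_ : (fun i => _) = gauss_pt Z m s t)//; apply/funext => i.
by have := d0 i; rewrite normr_le0 => /eqP ->; rewrite addr0.
Qed.

(** * Optimal weights and optimal bias *)

Section optimal.
Variables (eta sigma eps : R).
Hypotheses (sigma_gt1 : 1 < sigma) (eps_ge0 : 0 <= eps) (eps_lt : eps < eta).

(** Score of a class mean of coordinate size [m], counted towards the correct side, without the bias
    and after the worst perturbation. *)
Let margin (m : R) w := m * \sum_(i < n) w i - eps * \sum_(i < n) `|w i|.

Let tot_robE alpha w b : unit_l2 w ->
  tot_rob Z eps eta sigma alpha w b =
  (Phi ((- margin eta w - b) / sigma) + Phi (b - margin (alpha * eta) w)) / 2.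
Proof.
move=> w1; rewrite /tot_rob /Rrob_pos /Rrob_neg rob_err_pos// ?rob_err_neg//.
  set S := \sum_(i < n) w i; set L := \sum_(i < n) `|w i|.
  have -> : eps * L - eta * S - b = - margin eta w - b by rewrite /margin -/S -/L; ring.
  by have -> : eps * L + - (alpha * eta) * S + b = b - margin (alpha * eta) w
    by rewrite /margin -/S -/L; ring.
exact: lt_trans ltr01 _.
Qed.

Let w_opt : 'I_n -> R := fun=> (Num.sqrt n%:R)^-1.

Let sqrt_n : (0 < n)%N -> 0 < Num.sqrt n%:R :> R.
Proof. by move=> n0; rewrite sqrtr_gt0 ltr0n. Qed.

Let unit_w_opt : (0 < n)%N -> unit_l2 w_opt.
Proof.
move=> n0; rewrite /unit_l2 /w_opt/= sumr_const card_ord exprVn sqr_sqrtr// ?ler0n//.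
by rewrite -[LHS]mulr_natl mulfV// pnatr_eq0 -lt0n.
Qed.

Let sum_w_opt : (0 < n)%N -> \sum_(i < n) w_opt i = Num.sqrt n%:R.
Proof.
move=> n0; rewrite /w_opt/= sumr_const card_ord -[LHS]mulr_natl.
have := sqr_sqrtr (ler0n R n) => {1}<-.
by rewrite expr2 mulfK// gt_eqF// sqrt_n.
Qed.

Let l1_w_opt : (0 < n)%N -> \sum_(i < n) `|w_opt i| = Num.sqrt n%:R.
Proof.
move=> n0; rewrite -(sum_w_opt n0); apply: eq_bigr => i _.
by rewrite ger0_norm// invr_ge0 sqrtr_ge0.
Qed.

(** If the weights sum to less than the root of [n], then [w_opt] with the same bias has both
    margins strictly larger, so both [Phi] terms drop. Otherwise the chain sum, l1 norm, root of [n]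
    collapses. *)
Lemma robust_opt_weights alpha w b : 1 <= alpha ->
  is_f_rob Z eps eta sigma alpha w b ->
  \sum_(i < n) w i = Num.sqrt n%:R /\ \sum_(i < n) `|w i| = Num.sqrt n%:R.
Proof.
move=> a1 [w1 wmin]; have n0 := unit_l2_dim_gt0 n w w1.
have SL := sum_le_l1 n w; have Ln := unit_l1_le n w w1.
have [Sn|Sn] := leP (Num.sqrt n%:R) (\sum_(i < n) w i).
  by split; apply/eqP; rewrite eq_le; apply/andP; split => //; lra.
(* The margin is at most [m - eps] times the sum of the weights, since that sum is at most the l1
   norm; [w_opt] attains this bound with the largest possible sum. *)
have mlt m : eps < m -> margin m w < margin m w_opt.
  move=> em; rewrite /margin sum_w_opt// l1_w_opt//.
  have : eps * \sum_(i < n) w i <= eps * \sum_(i < n) `|w i| by rewrite ler_wpM2l.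
  have : (m - eps) * \sum_(i < n) w i < (m - eps) * Num.sqrt n%:R.
    by rewrite ltr_pM2l// subr_gt0.
  lra.
have ea : eps < alpha * eta.
  apply: lt_le_trans eps_lt _; rewrite ler_peMl//.
  exact: le_trans eps_ge0 (ltW eps_lt).
have := wmin w_opt b (unit_w_opt n0).
rewrite !tot_robE//; last exact: unit_w_opt.
rewrite ler_pM2r ?invr_gt0// leNgt => /negP[].
apply: ltrD; apply: Phi_lt.
  rewrite ltr_pM2r ?invr_gt0 ?(lt_trans ltr01)//.
  by have := mlt _ eps_lt; lra.
by have := mlt _ ea; lra.
Qed.

(** With both sums known, only the bias is free. In the variable [u] the total error is half of
    [thr_err sigma a], so [thr_err_min] determines [u], and the two conditional errors become the
    terms of [disp_fun]. *)
Lemma disp_rob_opt alpha w b : 1 <= alpha ->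
  is_f_rob Z eps eta sigma alpha w b ->
  disp_rob Z eps eta sigma alpha w b =
  disparity_formula n sigma (g_rob eps eta alpha).
Proof.
move=> a1 opt; have [S L] := robust_opt_weights _ _ _ a1 opt.
have [w1 wmin] := opt.
have s0 : 0 < sigma by exact: lt_trans ltr01 _.
have s20 : 0 < sigma ^+ 2 - 1 by rewrite subr_gt0 expr_gt1// ltW.
rewrite disparity_formulaE//; set a := A_const n sigma * _.
pose r : R := Num.sqrt n%:R.
(* This explains the constant [A]: multiplied by [1 - sigma ^- 2] it is [2 * r / sigma], and the two
   margins add up to [2 * r * g]. *)
have aE : a * (1 - sigma ^- 2) = (margin eta w + margin (alpha * eta) w) / sigma.
  rewrite /a /A_const /g_rob /margin S L -/r; field.
  by rewrite !gt_eqF.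
pose u := margin (alpha * eta) w - b.
have totE v : tot_rob Z eps eta sigma alpha w (margin (alpha * eta) w - v) =
    thr_err sigma a v / 2.
  rewrite tot_robE// /thr_err aE; set m1 := margin eta w; set m2 := margin _ w.
  have -> : (- m1 - (m2 - v)) / sigma = v / sigma - (m1 + m2) / sigma by ring.
  by have -> : m2 - v - m2 = - v by ring.
have uE : u = crit_sqrt sigma a - a / sigma.
  apply: thr_err_min => // v.
  (* The competitors keep the weights and move only the bias. *)
  have := wmin w (margin (alpha * eta) w - v) w1.
  have -> : b = margin (alpha * eta) w - u by rewrite /u; ring.
  by rewrite !totE ler_pM2r ?invr_gt0.
rewrite /disp_rob /Rrob_pos /Rrob_neg rob_err_pos// rob_err_neg// /disp_fun.
set S' := \sum_(i < n) w i; set L' := \sum_(i < n) `|w i|.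
have -> : crit_sqrt sigma a / sigma - a = u / sigma - a * (1 - sigma ^- 2).
  by rewrite uE; field; rewrite gt_eqF.
have -> : a / sigma - crit_sqrt sigma a = - u by rewrite uE; ring.
rewrite aE /u /margin -/S' -/L'.
have -> : (alpha * eta * S' - eps * L' - b) / sigma -
  (eta * S' - eps * L' + (alpha * eta * S' - eps * L')) / sigma =
  (eps * L' - eta * S' - b) / sigma by ring.
by have -> : eps * L' + - (alpha * eta) * S' + b =
  - (alpha * eta * S' - eps * L' - b) by ring.
Qed.

End optimal.
End errors.

Theorem theorem2 (R : realType) (dT : measure_display) (T : measurableType dT)
  (P : probability T R) (d : nat) (Z : 'I_d -> {RV P >-> R})
  (eta sigma alpha eps : R) :
  (0 < d)%N -> 0 < eta -> 1 < sigma -> 1 <= alpha -> 0 < eps -> eps < eta ->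
  (forall i, std_normal_rv (Z i)) -> mutually_independent Z ->
  (* standard error, f = f_nat *)
  (forall w b, is_f_nat Z eta sigma alpha w b ->
     disp_nat Z eta sigma alpha w b = disparity_formula d sigma (g_nat eta alpha))
  /\
  (* robust error, f = f_rob *)
  (forall w b, is_f_rob Z eps eta sigma alpha w b ->
     disp_rob Z eps eta sigma alpha w b
       = disparity_formula d sigma (g_rob eps eta alpha))
  /\
  (* monotone (strict) decrease of the disparity in alpha *)
  (forall a1 a2 w1 b1 w2 b2, 1 <= a1 -> a1 < a2 ->
     is_f_nat Z eta sigma a1 w1 b1 -> is_f_nat Z eta sigma a2 w2 b2 ->
     disp_nat Z eta sigma a2 w2 b2 < disp_nat Z eta sigma a1 w1 b1)
  /\
  (forall a1 a2 w1 b1 w2 b2, 1 <= a1 -> a1 < a2 ->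
     is_f_rob Z eps eta sigma a1 w1 b1 -> is_f_rob Z eps eta sigma a2 w2 b2 ->
     disp_rob Z eps eta sigma a2 w2 b2 < disp_rob Z eps eta sigma a1 w1 b1).
Proof.
move=> d0 eta0 sigma1 alpha1 eps0 eps_eta normZ indZ.
(* A standard minimizer is a robust one for radius 0, so the robust result serves both error
   notions. *)
have nat_rob a w b : is_f_nat Z eta sigma a w b -> is_f_rob Z 0 eta sigma a w b.
  move=> [w1 wmin]; split=> // w' b' /(wmin w' b').
  by rewrite /tot_nat /Rnat_pos /Rnat_neg !nat_errE.
have disp_natE a w b :
    disp_nat Z eta sigma a w b = disp_rob Z 0 eta sigma a w b.
  by rewrite /disp_nat /Rnat_pos /Rnat_neg !nat_errE.
have rob e a w b : 0 <= e -> e < eta -> 1 <= a ->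
    is_f_rob Z e eta sigma a w b ->
    disp_rob Z e eta sigma a w b = disparity_formula d sigma (g_rob e eta a).
  by move=> e0 e_eta a1 opt; apply: disp_rob_opt.
(* As [A] and [eta] are positive, [A * g] strictly increases with [alpha], whatever the radius. *)
have decr e a1 a2 : a1 < a2 ->
    disparity_formula d sigma (g_rob e eta a2) <
    disparity_formula d sigma (g_rob e eta a1).
  move=> a12; rewrite !disparity_formulaE//; apply: disp_fun_decr => //.
  rewrite ltr_pM2l.
    by rewrite /g_rob ltrD2r ltr_pM2r// ltr_pM2r ?invr_gt0// ltrD2l.
  have sigma0 : 0 < sigma := lt_trans ltr01 sigma1.
  rewrite /A_const divr_gt0 ?subr_gt0 ?expr_gt1 ?(ltW sigma0)//.
  by rewrite !mulr_gt0 ?sqrtr_gt0 ?ltr0n.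
have robP := rob _ _ _ _ (ltW eps0) eps_eta.
have natP a w b (a_ge1 : 1 <= a) (opt : is_f_nat Z eta sigma a w b) :=
  rob _ _ _ _ (lexx 0) eta0 a_ge1 (nat_rob _ _ _ opt).
split=> [w b opt|].
  by rewrite disp_natE (natP _ _ _ alpha1 opt) /g_rob subr0.
split=> [w b opt|]; first exact: robP.
split=> a1 a2 w1 b1 w2 b2 a1_ge1 a12 opt1 opt2;
  have a2_ge1 := le_trans a1_ge1 (ltW a12).
  by rewrite !disp_natE (natP _ _ _ a1_ge1 opt1) (natP _ _ _ a2_ge1 opt2); exact: decr.
by rewrite (robP _ _ _ a1_ge1 opt1) (robP _ _ _ a2_ge1 opt2); exact: decr.
Qed.
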